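(* Let $\mathcal{V}$ be a Hilbert space, $\mathcal{V}_h\subset\mathcal{V}_h^{+}\subset\mathcal{V}$ finite dimensional (finite element) subspaces, $B(\cdot,\cdot):\mathcal{V}\times\mathcal{V}\to\mathbb{R}$ a symmetric bilinear form, and $L:\mathcal{V}\to\mathbb{R}$ a linear functional. Let $J(u):=\sqrt{B(u,u)}$ be the energy induced by the bilinear form. Let $u\in\mathcal{V}$, $u_h\in\mathcal{V}_h$, $u_h^{+}\in\mathcal{V}_h^{+}$, $z\in\mathcal{V}$ and $z_h^{+}\in\mathcal{V}_h^{+}$ solve, respectively, $$B(u,\varphi)=L(\varphi)\quad\forall\varphi\in\mathcal{V},$$ $$B(u_h,\varphi_h)=L(\varphi_h)\quad\forall\varphi_h\in\mathcal{V}_h,$$ $$B(u_h^{+},\varphi_h^{+})=L(\varphi_h^{+})\quad\forall\varphi_h^{+}\in\mathcal{V}_h^{+},$$ $$B(\varphi,z)=J'(u_h;\varphi)\quad\forall\varphi\in\mathcal{V},$$ $$B(\varphi_h^{+},z_h^{+})=J'(u_h;\varphi_h^{+})\quad\forall\varphi_h^{+}\in\mathcal{V}_h^{+}.$$ Then the estimates of $J(u)-J(u_h)$ given by $$\eta_2:=L(z)-B(u_h,z)\qquad\text{and}\qquad\eta_3:=L(z_h^{+})-B(u_h,z_h^{+})$$ are not reliable.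
   Context: Derivatives: $J'(u;v):=\lim_{\varepsilon\to0}\varepsilon^{-1}[J(u+\varepsilon v)-J(u)]$ and $J''(u;v,w):=\lim_{\varepsilon\to0}\varepsilon^{-1}[J'(u+\varepsilon w;v)-J'(u;v)]$. Standing assumptions: $J:\mathcal{V}\to\mathbb{R}$ is a nonlinear functional with sufficient regularity such that its first and second Fréchet derivatives exist (these agree with $J'$ and $J''$), and the problem of finding $u\in\mathcal{V}$ with $B(u,\varphi)=L(\varphi)$ for all $\varphi\in\mathcal{V}$ is well-posed. Definition (reliable): an error estimate $\eta\approx J(u)-J(u_h)$ is said to be reliable if there exists a constant $C\in\mathbb{R}_{>0}$ independent of $u_h$ such that $|J(u)-J(u_h)|\le C|\eta|$.
   Formalization: It is additionally assumed that u_h ≠ u for at least one discretization (otherwise the error is zero and every estimate is trivially reliable), and that B(v,v) ≥ 0 for all v, so that J is defined; J need only be twice differentiable at u_h. *)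

(* Defs.v *)
From HB Require Import structures.
From mathcomp Require Import all_boot all_order all_algebra.
From mathcomp Require Import sesquilinear.
From mathcomp Require Import all_classical all_reals all_analysis.

Set Implicit Arguments.
Unset Strict Implicit.
Unset Printing Implicit Defensive.

Import Order.TTheory GRing.Theory Num.Theory.
Import numFieldNormedType.Exports.

Local Open Scope classical_set_scope.
Local Open Scope ring_scope.

(* A real Hilbert space is a complete normed module [V] whose norm is the one
   of an inner product [ip : {dot V for idfun}] (symmetric, bilinear, positive
   definite). *)
Definition norm_from_inner_product (R : realType) (V : completeNormedModType R)
    (ip : {dot V for idfun}) : Prop :=
  forall v : V, `|v| ^+ 2 = ip v v.

(* The span of a finite family is automatically a linear subspace. *)
Definition findim_subspace (R : realType) (V : completeNormedModType R)
    (W : set V) : Prop :=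
  exists (n : nat) (e : 'I_n -> V),
    W = [set \sum_(i < n) c i *: e i | c in [set: 'I_n -> R]].

(* [Num.sqrt] is 0 on negative numbers, so this is the energy only when
   [0 <= B v v] for all [v]. *)
Definition energy (R : realType) (V : completeNormedModType R)
    (B : {symmetric V}) : V -> R :=
  fun v => Num.sqrt (B v v).

(* Hadamard well-posedness of "find u such that B u phi = L phi for all phi":
   unique solvability for every datum differing from [L] by a continuous
   functional, and Lipschitz dependence of the solution on the datum at [L],
   perturbations being measured in the dual norm ([M] ranges over its upper
   bounds).  [L] itself is not required to be continuous; when it is, the
   admissible data are exactly the elements of the dual of [V]. *)
Definition well_posed (R : realType) (V : completeNormedModType R)
    (B : {symmetric V}) (L : {scalar V}) : Prop :=
  (forall L' : {scalar V}, continuous (fun phi : V => L' phi - L phi : R) ->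
     exists! u : V, forall phi : V, B u phi = L' phi) /\
  (exists c : R, forall (L' : {scalar V}) (u u' : V) (M : R),
     (forall phi : V, B u phi = L phi) ->
     (forall phi : V, B u' phi = L' phi) ->
     (forall phi : V, `|L' phi - L phi| <= M * `|phi|) ->
     `|u' - u| <= c * M).

(* [H] is the second Frechet derivative: the derivative at [a] of
   x |-> 'd J x, as a map into the dual of [V] with its operator norm, read
   as a bounded bilinear form. *)
Definition twice_differentiable (R : realType) (V : completeNormedModType R)
    (J : V -> R) (a : V) : Prop :=
  (\forall x \near a, differentiable J x) /\
  exists H : {biscalar V},
    (exists M : R, forall k w : V, `|H k w| <= M * `|k| * `|w|) /\
    forall e : R, 0 < e ->
      \forall k \near (0 : V), forall w : V,
        `|'d J (a + k) w - 'd J a w - H k w| <= e * `|k| * `|w|.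

(* Discretizations are indexed by [h : I], so that "C independent of u_h"
   means that one [C] serves all [h].  With [I := unit] this is the
   inequality for a single discretization. *)
Definition reliable (R : realType) (V : completeNormedModType R)
    (J : V -> R) (u : V) (I : Type) (u_h : I -> V) (eta : I -> R) : Prop :=
  exists C : R, 0 < C /\ forall h : I, `|J u - J (u_h h)| <= C * `|eta h|.

(* Main.v *)
Require Import Defs.
From HB Require Import structures.
From mathcomp Require Import all_boot all_order all_algebra.
From mathcomp Require Import sesquilinear.
From mathcomp Require Import all_classical all_reals all_analysis.
From mathcomp Require Import ring lra.

(** Both estimates vanish identically, while the error does not.  Write
    [w := u - u_h].  Galerkin orthogonality and the symmetry of [B] give
    [B u_h w = 0].  Hence the energy is even along the line through [u_h] in
    the direction [w], since [J (u_h + t w) ^ 2 = B u_h u_h + t ^ 2 * B w w],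
    and differentiability forces its directional derivative there to be 0
    ([derive_energy_orthogonal]).  So
    [L z - B u_h z = B w z = J'(u_h; w) = 0]; for the discrete dual problem
    the same argument applies with [u_hp] in place of [u].

    If either estimate were reliable, one would have [J u = J u_h] for every
    discretization; by Pythagoras [B w w = 0], so [w] lies in the radical of
    the positive semidefinite form [B] ([radical_of_isotropic]), which
    well-posedness makes trivial ([well_posed_radical0]).  Then [u_h = u] for
    every discretization, contrary to the assumption that one is inexact. *)

Set Implicit Arguments.
Unset Strict Implicit.
Unset Printing Implicit Defensive.

Import Order.TTheory GRing.Theory Num.Theory.
Import numFieldNormedType.Exports.

Local Open Scope classical_set_scope.
Local Open Scope ring_scope.

Section PositiveSymmetricForm.

Variables (R : realType) (V : completeNormedModType R) (B : {symmetric V}).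

Lemma symmetric_formC (x y : V) : B x y = B y x.
Proof. by rewrite hermC expr0 mul1r. Qed.

(* Bilinearity of [B], stated on its own coercion to functions so that the
   equations compose by rewriting. *)
Lemma symmetric_formDl (x y z : V) : B (x + y) z = B x z + B y z.
Proof. exact: linearDl. Qed.

Lemma symmetric_formDr (x y z : V) : B x (y + z) = B x y + B x z.
Proof. exact: linearDr. Qed.

Lemma symmetric_formBl (x y z : V) : B (x - y) z = B x z - B y z.
Proof. exact: linearBl. Qed.

Lemma symmetric_formBr (x y z : V) : B x (y - z) = B x y - B x z.
Proof. exact: linearBr. Qed.

Lemma symmetric_formZl (t : R) (x y : V) : B (t *: x) y = t * B x y.
Proof. exact: linearZl_LR. Qed.

Lemma symmetric_formZr (t : R) (x y : V) : B x (t *: y) = t * B x y.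
Proof. exact: linearZr_LR. Qed.

Lemma pythagoras (t : R) (a w : V) : B a w = 0 ->
  B (t *: w + a) (t *: w + a) = t ^+ 2 * B w w + B a a.
Proof.
move=> aw0.
rewrite symmetric_formDl !symmetric_formDr.
rewrite !symmetric_formZl !symmetric_formZr.
by rewrite (symmetric_formC w a) aw0 !mulr0 addr0 add0r mulrA expr2.
Qed.

Lemma radical_of_isotropic (w : V) :
  (forall v : V, 0 <= B v v) -> B w w = 0 -> forall phi : V, B w phi = 0.
Proof.
move=> B_ge0 ww0 phi; apply/eqP/negPn/negP => b0.
(* This [t] makes the affine function [t |-> B (t w + phi) (t w + phi)]
   equal to -1. *)
set t := - (B phi phi + 1) / (2 * B w phi).
have := B_ge0 (t *: w + phi).
rewrite symmetric_formDl !symmetric_formDr.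
rewrite !symmetric_formZl !symmetric_formZr ww0.
rewrite (symmetric_formC phi w) !mulr0 add0r.
have -> : t * B w phi = - (B phi phi + 1) / 2 by rewrite /t; field.
lra.
Qed.

Lemma well_posed_radical0 (L : {scalar V}) (w : V) :
  well_posed B L -> (forall phi : V, B w phi = 0) -> w = 0.
Proof.
case=> solvable _ w_rad.
have L_cont : continuous (fun phi : V => L phi - L phi : R).
  by under eq_fun do rewrite subrr; exact: cst_continuous.
have [u [u_sol u_uniq]] := solvable L L_cont.
have uw : u = u + w.
  by apply: u_uniq => phi; rewrite symmetric_formDl w_rad addr0 u_sol.
by apply: (addrI u); rewrite addr0 -uw.
Qed.

(** The case [a = 0] is included: the energy is differentiable there only
    when it vanishes identically. *)
Lemma derive_energy_orthogonal (a w : V) :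
  differentiable (energy B) a -> B a w = 0 -> 'D_w (energy B) a = 0.
Proof.
move=> J_diff aw0.
have odd_derive : 'D_(- w) (energy B) a = - 'D_w (energy B) a.
  by rewrite (deriveE (- w) J_diff) (deriveE w J_diff) linearN.
have even_derive : 'D_(- w) (energy B) a = 'D_w (energy B) a.
  rewrite /derive; under eq_fun => t.
    have -> : (energy B \o shift a) (t *: - w) = (energy B \o shift a) (t *: w).
      by rewrite /= /energy scalerN -scaleNr !pythagoras// sqrrN.
    over.
  by [].
by move: odd_derive; rewrite even_derive; lra.
Qed.

End PositiveSymmetricForm.

Lemma findim_subspaceB (R : realType) (V : completeNormedModType R)
    (W : set V) (x y : V) :
  findim_subspace W -> W x -> W y -> W (x - y).
Proof.
case=> n [e ->] [c _ <-] [d _ <-]; exists (fun i => c i - d i) => //.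
by rewrite -sumrB; apply: eq_bigr => i _; rewrite scalerBl.
Qed.

(** Here [a] is the discrete solution, [z] solves a dual problem tested on
    [W], and [u'] solves the primal problem at least against [a] and [z].  The
    difference [u' - a] is an admissible test function, and the derivative of
    the energy vanishes in that direction.  With [W := setT] this covers the
    exact dual problem. *)
Lemma dual_weighted_residual0 (R : realType) (V : completeNormedModType R)
    (B : {symmetric V}) (L : {scalar V}) (W : set V) (a u' z : V) :
  differentiable (energy B) a -> B a a = L a -> B u' a = L a ->
  W (u' - a) -> B u' z = L z ->
  (forall phi : V, W phi -> B phi z = 'D_phi (energy B) a) ->
  L z - B a z = 0.
Proof.
move=> J_diff aa u'a Wu'a u'z z_sol.
rewrite -u'z -symmetric_formBl z_sol// derive_energy_orthogonal//.
by rewrite symmetric_formC symmetric_formBl aa u'a subrr.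
Qed.

(** An identically zero estimate of a nonzero error is not reliable. *)
Lemma not_reliable0 (R : realType) (V : completeNormedModType R)
    (J : V -> R) (u : V) (I : Type) (u_h : I -> V) (eta : I -> R) :
  (forall h, eta h = 0) -> (exists h, J u <> J (u_h h)) ->
  ~ reliable J u u_h eta.
Proof.
move=> eta0 [h Jh] [C [_ /(_ h)]]; rewrite eta0 normr0 mulr0 normr_le0.
by rewrite subr_eq0 => /eqP.
Qed.

Theorem corollary1 (R : realType) (V : completeNormedModType R)
    (ip : {dot V for idfun}) (hilbertV : norm_from_inner_product ip)
    (B : {symmetric V}) (L : {scalar V})
    (B_ge0 : forall v : V, 0 <= B v v)
    (wpB : well_posed B L)
    (u : V) (u_sol : forall phi : V, B u phi = L phi)
    (I : Type) (V_h V_hp : I -> set V)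
    (V_h_findim : forall h : I, findim_subspace (V_h h))
    (V_hp_findim : forall h : I, findim_subspace (V_hp h))
    (V_h_sub : forall h : I, V_h h `<=` V_hp h)
    (u_h u_hp z z_hp : I -> V)
    (u_h_in : forall h : I, V_h h (u_h h))
    (u_hp_in : forall h : I, V_hp h (u_hp h))
    (z_hp_in : forall h : I, V_hp h (z_hp h))
    (u_h_sol : forall (h : I) (phi : V), V_h h phi -> B (u_h h) phi = L phi)
    (u_hp_sol : forall (h : I) (phi : V), V_hp h phi -> B (u_hp h) phi = L phi)
    (J_regular : forall h : I, twice_differentiable (energy B) (u_h h))
    (z_sol : forall (h : I) (phi : V),
       B phi (z h) = 'D_phi (energy B) (u_h h))
    (z_hp_sol : forall (h : I) (phi : V), V_hp h phi ->
       B phi (z_hp h) = 'D_phi (energy B) (u_h h))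
    (not_exact : exists h : I, u_h h <> u) :
  ~ reliable (energy B) u u_h (fun h : I => L (z h) - B (u_h h) (z h)) /\
  ~ reliable (energy B) u u_h (fun h : I => L (z_hp h) - B (u_h h) (z_hp h)).
Proof.
have J_diff h : differentiable (energy B) (u_h h).
  by have [/nbhs_singleton] := J_regular h.
have u_h_self h : B (u_h h) (u_h h) = L (u_h h) by exact: u_h_sol.
have inexact : exists h, energy B u <> energy B (u_h h).
  have [h u_hDu] := not_exact; exists h => /eqP.
  rewrite /energy eqr_sqrt// => /eqP energy_eq; apply: u_hDu.
  have orth : B (u_h h) (u - u_h h) = 0.
    by rewrite symmetric_formBr symmetric_formC u_sol u_h_self subrr.
  have := pythagoras 1 orth.
  rewrite scale1r subrK expr1n mul1r energy_eq => iso.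
  have {}iso : B (u - u_h h) (u - u_h h) = 0 by lra.
  have := well_posed_radical0 wpB (radical_of_isotropic B_ge0 iso).
  by move/eqP; rewrite subr_eq0 => /eqP.
split; apply: not_reliable0 => // h.
- by apply: (@dual_weighted_residual0 _ _ _ _ setT _ u) => // phi _.
- have u_h_in_hp : V_hp h (u_h h) by exact/V_h_sub/u_h_in.
  apply: (@dual_weighted_residual0 _ _ _ _ (V_hp h) _ (u_hp h)) => //.
  + exact: u_hp_sol.
  + exact: findim_subspaceB.
  + exact: u_hp_sol.
  + exact: z_hp_sol.
Qed.
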